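(* Let $p$ be a prime and $\alpha,l,n,r\in\mathbb{N}$. If $r>n-(l+1)p^{\alpha}$, then $$\operatorname{ord}_p\Big([x^r]\frac{(1-x)^n}{(1-x^{p^{\alpha}})^{l+1}}\Big)\ \geqslant\ \operatorname{ord}_p\Big(\Big\lfloor\frac{n}{p^{\alpha-1}}\Big\rfloor!\Big)-l-\operatorname{ord}_p(l!)+\tau_p\big(\{r\}_{p^{\alpha-1}},\{n-r\}_{p^{\alpha-1}}\big).$$
   Context: $[x^r]F(x)$ denotes the coefficient of $x^r$ in the power series expansion of $F(x)$. $\operatorname{ord}_p$ is the $p$-adic order ($\operatorname{ord}_p(0)=+\infty$). For an integer $a$ and positive real $m$, $\{a\}_m$ is the unique number in $[0,m)$ with $a-\{a\}_m\in m\mathbb{Z}$. $\tau_p(a,b)$ is the number of carries when adding $a,b\in\mathbb{N}$ in base $p$. When $\alpha=0$, $\lfloor n/p^{-1}\rfloor=pn$. *)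

(* Defs.v *)
From mathcomp Require Import all_boot all_order all_algebra.
Set Implicit Arguments. Unset Strict Implicit. Unset Printing Implicit Defensive.
Import Order.TTheory GRing.Theory Num.Theory.

(* ord_p of an integer z <> 0 (the case z = 0, ord = +oo, is handled
   separately in the statement). *)
Definition ordp (p : nat) (z : int) : nat := logn p `|z|%N.

Definition digit (p i a : nat) : nat := (a %/ p ^ i) %% p.

Fixpoint carry (p a b i : nat) : bool :=
  match i with
  | 0 => false
  | i'.+1 => p <= digit p i' a + digit p i' b + carry p a b i'
  end.

(* tau_p(a,b): number of carries when adding a and b in base p.
   Positions beyond a+b produce no carry (p >= 2), so counting
   positions 0..a+b suffices. *)
Definition tau (p a b : nat) : nat :=
  \sum_(i < (a + b).+1) carry p a b i.+1.

(* { a }_{p^(alpha-1)}: for alpha >= 1 the least nonnegative residue of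
   the integer a modulo p^(alpha-1); for alpha = 0 the modulus is 1/p and
   every integer lies in (1/p)Z, so the value is 0. *)
Definition fracp (p alpha : nat) (a : int) : nat :=
  if alpha is alpha'.+1 then `|(a %% (p ^ alpha')%:Z)%Z|%N else 0.

(* floor(n / p^(alpha-1)), with the convention floor(n/p^{-1}) = p n *)
Definition floorp (p alpha n : nat) : nat :=
  if alpha is alpha'.+1 then n %/ p ^ alpha' else p * n.

(* Main.v *)
Require Import Defs.
From mathcomp Require Import all_boot all_order all_algebra.
From mathcomp Require Import zify ring.
Import Order.TTheory GRing.Theory Num.Theory.
Local Open Scope ring_scope.

(** Write [P = p^a] with [a = alpha - 1], [n = N P + s] with [s < P], and
    [(1-x)^P = (1-x^P) + p h].  Then the quotient is the sum over [k] of
    [C(N,k) p^k h^k (1-x)^s (1-x^P)^(N-k) / (1-x^(pP))^(l+1)].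
    In the last factor [y = x^P] reduces the matter to the coefficients of
    [(1-y)^i / (1-y^p)^(l+1)] with [i = N - k]; multiplied by [l! p^l] they are
    divisible by the [p]-part of [i!]: this is Fleck's congruence for [l = 0], and
    the operator [y d/dy] gives the induction on [l].  The carries come from the
    coefficients of [h^k (1-x)^s]: Kummer's theorem handles [(1-x)^s], and as the
    derivative of [h] is divisible by [p^(a-1)] the factor [h^k] loses at most one
    carry.  Since [ord_p(k!) <= k - 1] for [k > 0], the factor [p^k] pays for this
    loss and for the [k!] in [C(N,k) = N! / (k! (N-k)!)].  The hypothesis on [r]
    makes polynomial parts vanish.
    For [alpha = 0] the quotient is a polynomial of degree [< r] unless [n <= l],
    and then the bound is not positive. *)

(** * Carries and borrows in base [p], and orders of factorials *)

Lemma carryE (p a b i : nat) : (1 < p)%N ->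
  carry p a b i = (p ^ i <= a %% p ^ i + b %% p ^ i)%N.
Proof.
move=> p1; elim: i => [|i IH] /=; first by rewrite expn0 !modn1.
rewrite IH /digit.
have P0 : (0 < p ^ i)%N by rewrite expn_gt0 ltnW.
have modS x : (x %% p ^ i.+1 = x %/ p ^ i %% p * p ^ i + x %% p ^ i)%N.
  rewrite {1}(divn_eq x (p ^ i)) {1}(divn_eq (x %/ p ^ i) p) mulnDl -mulnA -expnS.
  rewrite -addnA modnMDl modn_small // expnS.
  have := ltn_pmod (x %/ p ^ i) (ltnW p1); have := ltn_pmod x P0; nia.
rewrite !modS expnS.
have := ltn_pmod a P0; have := ltn_pmod b P0.
move: (a %% _)%N (b %% p ^ i)%N => u v; move: (_ %% p)%N (_ %% p)%N => x y.
move: (p ^ i)%N P0 => P P0 hv hu.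
case: leqP => h /=; apply/idP/idP; nia.
Qed.

(* The number of borrows at the [a] lowest positions when subtracting [t] from [s] in
   base [p], that is, of carries there when adding [t] to [s - t] modulo [p^a]. *)
Definition borrows (p a s t : nat) : nat :=
  \sum_(i < a) (s %% p ^ i.+1 < t %% p ^ i.+1)%N.

Lemma borrows_mod (p a s t s' t' : nat) :
  s = s' %[mod p ^ a] -> t = t' %[mod p ^ a] ->
  borrows p a s t = borrows p a s' t'.
Proof.
move=> hs ht; apply: eq_bigr => i _.
have d : (p ^ i.+1 %| p ^ a)%N by rewrite dvdn_exp2l.
by rewrite -(modn_dvdm s d) -(modn_dvdm t d) hs ht !modn_dvdm.
Qed.

Lemma borrowsS (p a s t : nat) : (borrows p a.+1 s t <= (borrows p a s t).+1)%N.
Proof. by rewrite /borrows big_ord_recr /=; case: (_ < _)%N; rewrite ?addn1 ?addn0. Qed.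

(** Positions below [v] see the same residues of [u] and [t]; each of the [a - v] others adds at
    most one borrow. *)
Lemma borrows_near (p v a s t u : nat) : u = t %[mod p ^ v] -> (v <= a)%N ->
  (borrows p a s u <= borrows p a s t + (a - v))%N.
Proof.
move=> h va; rewrite /borrows -(subnKC va) !big_split_ord /= addKn.
have /(_ s s erefl) := borrows_mod p v _ _ _ _ _ h; rewrite /borrows => ->.
rewrite -addnA leq_add2l; apply: leq_trans (leq_addl _ _).
apply: (@leq_trans (\sum_(i < a - v) 1)); last by rewrite sum1_card card_ord.
by apply: leq_sum => i _; rewrite leq_b1.
Qed.

(** Used to turn a carry of [x + y] into a borrow of [(x + y) - x], position by position. *)
Lemma modn_add_lt (m x y : nat) : (0 < m)%N ->
  (m <= x %% m + y %% m)%N = ((x + y) %% m < x %% m)%N.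
Proof.
move=> m0; rewrite (modnD _ _ m0).
have := ltn_pmod x m0; have := ltn_pmod y m0.
by case: leqP => /=; lia.
Qed.

Lemma tau_le_borrows (p A a b n r : nat) : (1 < p)%N ->
  (a < p ^ A)%N -> (b < p ^ A)%N -> a = r %[mod p ^ A] ->
  a + b = n %[mod p ^ A] -> (tau p a b <= borrows p A n r)%N.
Proof.
move=> p1 aA bA ar abn.
rewrite -(borrows_mod _ _ _ _ _ _ abn ar) /tau /borrows.
rewrite (big_ord_widen _ (fun i => carry p a b i.+1 : nat) (leq_addr A _)).
rewrite (big_ord_widen _ (fun i => ((a + b) %% p ^ i.+1 < a %% p ^ i.+1)%N : nat)
  (leq_addl (a + b).+1 A)).
rewrite [X in (X <= _)%N]big_mkcond [X in (_ <= X)%N]big_mkcond; apply: leq_sum => i _.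
rewrite carryE // modn_add_lt ?expn_gt0 ?(ltnW p1) //.
case: ifP => _; case: (ltnP i A) => // Ai; last first.
(* From position [A] on there is no carry, since [a + b < 2 * p ^ A <= p ^ i.+1]. *)
have PiA : (p * p ^ A <= p ^ i.+1)%N by rewrite -expnS leq_exp2l.
by rewrite !modn_small; nia.
Qed.

Lemma logn_fact_widen (p n M : nat) : prime p -> (n <= M)%N ->
  logn p n`! = (\sum_(i < M) n %/ p ^ i.+1)%N.
Proof.
move=> pp nM; rewrite logn_fact // big_add1 /= big_mkord.
rewrite (big_ord_widen _ (fun i => n %/ p ^ i.+1)%N nM) big_mkcond; apply: eq_bigr => i _.
case: ltnP => // ni; rewrite divn_small //.
by apply: leq_ltn_trans ni _; apply: ltn_trans (ltn_expl _ (prime_gt1 pp)).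
Qed.

(* The lower bound in Kummer's theorem; it is vacuous for [s < t]. *)
Lemma dvdn_bin_borrows (p a s t : nat) : prime p ->
  (p ^ borrows p a s t %| 'C(s, t))%N.
Proof.
move=> pp; case: (leqP t s) => ts; last by rewrite bin_small.
rewrite pfactor_dvdn ?bin_gt0 //.
have := congr1 (logn p) (bin_fact ts).
rewrite !lognM ?muln_gt0 ?fact_gt0 ?bin_gt0 //.
rewrite !(fun n h => logn_fact_widen p n (s + a) pp h); try lia.
rewrite -big_split /= -(leq_add2r (\sum_(i < s + a) (t %/ p ^ i.+1 + (s - t) %/ p ^ i.+1))).
move=> ->; rewrite /borrows (big_ord_widen _ (fun i => (s %% p ^ i.+1 < t %% p ^ i.+1)%N : nat) (leq_addl s a)) big_mkcond -big_split /=.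
apply: leq_sum => i _.
have P0 : (0 < p ^ i.+1)%N by rewrite expn_gt0 prime_gt0.
have := divnD t (s - t) P0; rewrite modn_add_lt // subnKC // => ->.
by rewrite addnC leq_add2l; case: ifP.
Qed.

Lemma logn_fact_div (p n : nat) : prime p ->
  logn p n`! = (n %/ p + logn p (n %/ p)`!)%N.
Proof.
move=> pp; rewrite (logn_fact_widen _ _ n.+1 pp) // big_ord_recl expn1.
rewrite (logn_fact_widen _ _ n pp) ?leq_div //; congr (_ + _)%N.
by apply: eq_bigr => i _; rewrite expnS divnMA.
Qed.

(** By Legendre's formula, with [m = n %/ p > 0], the induction step reads
    [p.-1 * m + m.-1 < p * m <= n]. *)
Lemma leq_logn_fact (p n : nat) : prime p -> (p.-1 * logn p n`! <= n.-1)%N.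
Proof.
move=> pp; have p1 := prime_gt1 pp.
elim/ltn_ind: n => [[|n]] IH; first by rewrite fact0 logn1 muln0.
rewrite logn_fact_div //; have lt : (n.+1 %/ p < n.+1)%N by rewrite ltn_Pdiv.
have := IH _ lt; have := leq_divM n.+1 p.
move: (n.+1 %/ p)%N => m; case: m => [|m] /=.
  by rewrite fact0 logn1 muln0.
move: (logn _ _) => L; case: p {pp lt IH} p1 => // p; nia.
Qed.

(** * Truncated geometric series in place of power series *)

(* A truncation of [1 / (1 - x^q)], exact below degree [q M]. *)
Definition geom (q M : nat) : {poly int} := \sum_(k < M) 'X^q ^+ k.

Lemma geom_cancel (q M : nat) : (1 - 'X^q) * geom q M = 1 - 'X^(q * M).
Proof. by rewrite -(opprB 'X^q) mulNr -subrX1 opprB -exprM. Qed.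

(** The error in [geom_cancel] is a multiple of ['X^(q * M)], invisible at degree
    [e < M <= q * M]. *)
Lemma geomK (q M L e : nat) (F : {poly int}) : (0 < q)%N -> (e < M)%N ->
  ((1 - 'X^q) * F * geom q M ^+ L.+1)`_e = (F * geom q M ^+ L)`_e.
Proof.
move=> q0 eM.
have -> : (1 - 'X^q) * F * geom q M ^+ L.+1
    = F * geom q M ^+ L - F * geom q M ^+ L * 'X^(q * M).
  by rewrite exprS mulrACA geom_cancel; ring.
by rewrite coefB coefMXn ifT ?subr0 //; nia.
Qed.

Lemma geomK_exp (q M L j e : nat) (F : {poly int}) : (0 < q)%N -> (e < M)%N ->
  ((1 - 'X^q) ^+ j * F * geom q M ^+ (L + j))`_e = (F * geom q M ^+ L)`_e.
Proof.
move=> q0 eM; elim: j => [|j IH]; first by rewrite expr0 mul1r addn0.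
by rewrite exprS -(mulrA (1 - 'X^q)) addnS geomK.
Qed.

(** The truncation of [c] to a polynomial, times [(1 - 'X^q) ^+ L], agrees with [F] up to degree
    [r]; multiplying by [geom q M ^+ L] cancels that factor. *)
Lemma coef_quotient (q M L : nat) (F : {poly int}) (c : nat -> int) (r : nat) :
  (0 < q)%N -> (r < M)%N ->
  (forall m : nat,
     \sum_(j < m.+1) ((1 - 'X^q) ^+ L : {poly int})`_j * c (m - j)%N = F`_m) ->
  c r = (F * geom q M ^+ L)`_r.
Proof.
move=> q0 rM hc.
have cE k : (k < M)%N -> (\poly_(i < M) c i)`_k = c k by move=> kM; rewrite coef_poly kM.
rewrite -(cE r rM) -[\poly_(i < M) _]mulr1 -(expr0 (geom q M)) -(geomK_exp q M 0 L) //.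
rewrite add0n !coefM; apply: eq_bigr => i _; congr (_ * _).
rewrite -hc coefM; apply: eq_bigr => j _; rewrite cE //.
by have := ltn_ord i; have := ltn_ord j; lia.
Qed.

(** * Polynomial sizes and the Frobenius congruence modulo [p] *)

Lemma coefM_size (A B : {poly int}) (m e : nat) : (size A <= m)%N ->
  (A * B)`_e = \sum_(u < m) A`_u * (if (e < u)%N then 0 else B`_(e - u)).
Proof.
move=> sA; have {1}-> : A = \poly_(u < m) A`_u.
  apply/polyP => k; rewrite coef_poly; case: ltnP => // mk.
  by rewrite nth_default // (leq_trans sA).
rewrite poly_def mulr_suml coef_sum; apply: eq_bigr => u _.
by rewrite -scalerAl coefZ coefXnM.
Qed.

Lemma size_subXn (n : nat) : (size (1 - 'X^n : {poly int})%R <= n.+1)%N.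
Proof.
apply: (leq_trans (size_polyD _ _)).
by rewrite size_polyN size_polyXn size_poly1 geq_max /=.
Qed.

Lemma size_exp_leq (h : {poly int}) (d k : nat) : (size h <= d.+1)%N ->
  (size (h ^+ k)%R <= (k * d).+1)%N.
Proof.
move=> sh; apply: leq_trans (leqSpred _) _; rewrite ltnS size_exp mulnC leq_mul2l.
by case: size sh => [|m]; rewrite ?orbT //= ltnS => ->; rewrite orbT.
Qed.

Lemma size_sub1X_exp (n : nat) : (size ((1 - 'X) ^+ n : {poly int})%R <= n.+1)%N.
Proof. by rewrite -{2}(muln1 n) size_exp_leq // -['X]expr1 size_subXn. Qed.

Lemma sub1X_exp_frobenius (p a : nat) : prime p ->
  exists2 h : {poly int}, (size h <= (p ^ a).+1)%N &
    (1 - 'X) ^+ (p ^ a) = 1 - 'X^(p ^ a) + p%:Z *: h.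
Proof.
move=> pp; set P := (p ^ a)%N.
pose D : {poly int} := (1 - 'X) ^+ P - (1 - 'X^P).
have Dp k : (p%:Z %| D`_k)%Z.
  have cp : p \in [pchar {poly 'F_p}] by rewrite pchar_poly pchar_Fp.
  rewrite (dvdz_pcharf (pchar_Fp pp)) -[_%:~R]/(intr _) -coef_map.
  rewrite !rmorphB /= rmorphXn /= rmorphB /= map_polyX map_polyXn rmorph1.
  have nP : [pchar {poly 'F_p}].-nat P by rewrite pnatX pnatE ?cp.
  by rewrite exprDn_pchar // exprNn_pchar // expr1n subrr coef0.
exists (\poly_(i < P.+1) (D`_i %/ p%:Z)%Z); first exact: size_poly.
apply: (addrI (- (1 - 'X^P))); rewrite addKr addrC -/D.
apply/polyP => k; rewrite coefZ coef_poly; case: ltnP => kP.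
  by rewrite mulrC divzK.
rewrite mulr0 nth_default //; apply: leq_trans kP.
apply: (leq_trans (size_polyD _ _)).
by rewrite size_polyN geq_max size_subXn size_sub1X_exp.
Qed.

(** Both [(1 - 'X) ^+ p] and [1 - 'X^p] vanish at 1, which splits a factor [1 - 'X] off the
    remainder. Thus only [p.-1] factors [1 - 'X] are traded for one [p]. *)
Lemma sub1X_exp_prime (p : nat) : prime p ->
  exists2 h : {poly int}, (size h <= p)%N &
    (1 - 'X) ^+ p = 1 - 'X^p + p%:Z *: ((1 - 'X) * h).
Proof.
move=> pp; have [g sg] := sub1X_exp_frobenius p 1 pp; rewrite expn1 => E.
have p0 := prime_gt0 pp.
have /factor_theorem[h gE] : root g 1.
  have := congr1 (horner^~ 1) E; rewrite !hornerE expr1n subrr expr0n.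
  rewrite -[p == 0%N]negbK -lt0n p0 /= add0r => /esym/eqP.
  by rewrite mulf_eq0 => /orP[|//]; rewrite eqz_nat eqn0Ngt p0.
exists (- h); last by rewrite E gE polyC1; congr (_ + _ *: _); ring.
rewrite size_polyN; have [->|h0] := eqVneq h 0; first by rewrite size_poly0.
move: sg; rewrite gE size_Mmonic ?monicXsubC // size_XsubC addn2 /= expn1.
by rewrite ltnS.
Qed.

(** * Fleck's congruence and its extension to powers of the denominator *)

(** As [i < e + p], the coefficient is the full alternating sum of the ['C(i, j)] with [j] congruent
    to [e] modulo [p]. In the induction one term is a polynomial of degree [i - p < e]; the other
    gains a [p] and lowers [i] by [p.-1]. *)
Lemma dvdz_fleck (p M e i : nat) : prime p -> (e < M)%N -> (i < e + p)%N ->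
  (p%:Z ^+ (i.-1 %/ p.-1) %| ((1 - 'X) ^+ i * geom p M)`_e)%Z.
Proof.
move=> pp; have p1 := prime_gt1 pp.
have [h sh hE] := sub1X_exp_prime p pp.
elim/ltn_ind: i e => i IH e eM ie.
have [ip|pi] := ltnP i p; first by rewrite divn_small ?dvd1z //; lia.
have -> : (1 - 'X) ^+ i * geom p M =
    (1 - 'X^p) * (1 - 'X) ^+ (i - p) * geom p M ^+ 1
    + p%:Z *: (h * ((1 - 'X) ^+ (i - p).+1 * geom p M)).
  rewrite -{1}(subnKC pi) exprD hE mulrDl mulrDl -!scalerAl expr1.
  by congr (_ + _ *: _); rewrite exprS; ring.
rewrite coefD geomK ?(ltnW p1) // expr0 mulr1 nth_default ?add0r; last first.
  by apply: leq_trans (size_sub1X_exp _) _; lia.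
rewrite coefZ (coefM_size _ _ p) //.
have -> : (i.-1 %/ p.-1 = ((i - p).+1.-1 %/ p.-1).+1)%N.
  have -> : (i.-1 = (i - p).+1.-1 + 1 * p.-1)%N by lia.
  by rewrite divnDMl ?addn1 //; lia.
rewrite (exprS p%:Z) dvdz_mul2l; last by rewrite eqz_nat; lia.
rewrite rpred_sum //
=> u _; rewrite dvdz_mull //; case: ltnP => // ue.
by have := ltn_ord u; move=> up; apply: IH; lia.
Qed.

(* Multiplying the derivative of [geom_cancel] by [geom p M] shows that
   [x V' = q x^q V^2] up to high order terms, for [V = geom q M]. *)
Lemma coef_geom_deriv (q M L e : nat) (F : {poly int}) :
  (0 < q)%N -> (e + q < M)%N ->
  (F * geom q M ^+ L.+2)`_e *+ (L.+1 * q) =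
  (F * geom q M ^+ L.+1)`_(e + q) *+ (e + q)
  - ('X * F^`() * geom q M ^+ L.+1)`_(e + q).
Proof.
move=> q0 eM; move: (geom q M) (geom_cancel q M) => V hV; set A := F * V ^+ L.+1.
have XV : 'X * V^`() = q%:R * 'X^q * V ^+ 2
    + 'X^(q * M) * ('X * V^`() - (q * M)%:R * V).
  have dX n : (0 < n)%N -> 'X * ('X^n)^`() = n%:R * 'X^n :> {poly int}.
    by case: n => // n _; rewrite derivXn /= -mulr_natl mulrCA -exprS.
  have qM0 : (0 < q * M)%N by nia.
  have := congr1 (fun A : {poly int} => 'X * A^`()) hV.
  rewrite derivM !derivB -polyC1 derivC polyC1 !sub0r mulrDr mulrA mulrN mulrN dX //.
  rewrite (dX _ qM0) => E.
  have {}E : (1 - 'X^q) * ('X * V^`()) = q%:R * 'X^q * V - (q * M)%:R * 'X^(q * M).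
    by rewrite -[RHS]/(_ + - _) -E; ring.
  have -> : q%:R * 'X^q * V ^+ 2
      = V * ((1 - 'X^q) * ('X * V^`())) + V * ((q * M)%:R * 'X^(q * M)).
    by rewrite E; ring.
  rewrite mulrCA [V * ('X * _)]mulrC -mulrA [V * _]mulrCA.
  have -> : (1 - 'X^q) * ('X * (V^`() * V)) = ((1 - 'X^q) * V) * ('X * V^`()) by ring.
  by rewrite hV; ring.
set Z := 'X * V^`() - (q * M)%:R * V in XV.
have XA : 'X * A^`() = 'X * F^`() * V ^+ L.+1
    + 'X^q * (F * V ^+ L.+2) *+ (L.+1 * q)
    + 'X^(q * M) * (F * V ^+ L * Z *+ L.+1).
  rewrite /A derivM deriv_exp /= mulrDr mulrA -addrA; congr (_ + _).
  have -> : 'X * (F * (V^`() * V ^+ L *+ L.+1)) = F * V ^+ L * ('X * V^`()) *+ L.+1.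
    by rewrite !mulrnAr; congr (_ *+ _); ring.
  clearbody Z; rewrite XV (mulnC L.+1) mulrnA [X in _ = _ + X]mulrnAr -mulrnDl; congr (_ *+ _).
  by rewrite -mulr_natl !exprS; ring.
have := congr1 (fun B : {poly int} => B`_(e + q)) XA.
rewrite !coefD coefMn coefXnM ltnNge leq_addl addnK /=.
rewrite coefXnM ifT; last by nia.
rewrite coefXM addn_eq0 (negPf (lt0n_neq0 q0)) andbF coef_deriv prednK ?addn_gt0 ?q0 ?orbT //.
by rewrite addr0 => ->; rewrite addrAC subrr add0r.
Qed.

(** [coef_geom_deriv] lowers the power of [geom] for a factor [l.+1 * p] and a shift of [e] by [p].
    In the derivative term [i] drops by one, and the factor [i] it produces restores the order of
    [i!]. *)
Lemma dvdz_coef_sub1X_geom (p M l e i : nat) : prime p ->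
  (i < e + l.+1 * p)%N -> (e + l * p < M)%N ->
  (p%:Z ^+ logn p i`! %| (l`! * p ^ l)%:Z * ((1 - 'X) ^+ i * geom p M ^+ l.+1)`_e)%Z.
Proof.
move=> pp; have p0 := prime_gt0 pp; have p1 := prime_gt1 pp.
elim: l e i => [|l IH] e i ie eM.
  rewrite mul1r expr1; apply: (dvdz_trans _ (dvdz_fleck _ _ _ _ pp _ _)); try lia.
  apply: dvdz_exp2l; rewrite leq_divRL; last by lia.
  by rewrite mulnC leq_logn_fact.
set c := _%:Z.
have -> : c * ((1 - 'X) ^+ i * geom p M ^+ l.+2)`_e =
    (l`! * p ^ l)%:Z * (((1 - 'X) ^+ i * geom p M ^+ l.+2)`_e *+ (l.+1 * p)).
  by rewrite /c factS expnS !PoszM -mulr_natl natz PoszM; ring.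
rewrite coef_geom_deriv //; last by lia.
rewrite mulrBr rpredB //; first by rewrite mulrnAr rpredMn //; apply: IH; lia.
case: i ie => [|i] ie.
  by rewrite expr0 -polyC1 derivC mulr0 mul0r coef0 mulr0 dvdz0.
rewrite deriv_exp /= derivB -polyC1 derivC derivX sub0r polyC1.
have -> : 'X * (-1 * (1 - 'X) ^+ i *+ i.+1) * geom p M ^+ l.+1 =
    'X * (- ((1 - 'X) ^+ i * geom p M ^+ l.+1) *+ i.+1).
  by rewrite mulN1r -mulrA mulrnAl mulNr.
rewrite coefXM ifF; last by lia.
rewrite coefMn coefN factS lognM ?fact_gt0 // exprD.
rewrite -mulr_natl natz mulrCA dvdz_mul //.
  by rewrite -(natz p) -natrX natz dvdzE /= pfactor_dvdnn.
by rewrite mulrN rpredN; apply: IH; lia.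
Qed.

(** * Borrows in the coefficients of [h ^+ k * (1 - 'X) ^+ s] *)

Lemma coef_sub1X_exp (n t : nat) :
  ((1 - 'X) ^+ n : {poly int})`_t = (-1) ^+ t * 'C(n, t)%:Z.
Proof.
have -> : (1 - 'X) ^+ n = \poly_(i < n.+1) ((-1) ^+ i * 'C(n, i)%:Z).
  rewrite exprBn poly_def; apply: eq_bigr => i _.
  by rewrite expr1n mulr1 -mul_polyC rmorphM rmorphXn rmorphN1 /= -natz rmorph_nat -mulrA mulr_natl mulrnAr.
by rewrite coef_poly; case: ltnP => // nt; rewrite bin_small ?mulr0.
Qed.

Lemma dvdz_exp_natl (p k : nat) (x : int) : (p%:Z ^+ k %| x)%Z = (p ^ k %| `|x|)%N.
Proof. by rewrite -(natz p) -natrX natz dvdzE. Qed.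

Lemma dvdz_exp_minn (p b m : nat) (x : int) : prime p -> (0 < m)%N ->
  (p%:Z ^+ b %| x *+ m)%Z -> (p%:Z ^+ (b - minn b (logn p m)) %| x)%Z.
Proof.
move=> pp m0; rewrite -mulr_natl natz !dvdz_exp_natl abszM absz_nat.
have [->|x0] := eqVneq x 0; first by rewrite dvdn0.
rewrite !pfactor_dvdn ?muln_gt0 ?m0 ?absz_gt0 // lognM ?absz_gt0 //.
by rewrite leq_subLR; move: (logn p m) => u; rewrite minnC /minn; case: ltnP; lia.
Qed.

(* A coefficient [G_m] with [p^b | m G_m] compensates for the borrows that may be
   lost when the index is shifted by [m], as only the positions above
   [logn p m] are affected. *)
Lemma dvdz_coef_borrows (p b s u : nat) (G E : {poly int}) : prime p ->
  G^`() = p%:Z ^+ b *: E ->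
  (p%:Z ^+ borrows p b s u %| (G * (1 - 'X) ^+ s)`_u)%Z.
Proof.
move=> pp hG; rewrite coefM rpred_sum // => -[m /= mu] _; rewrite ltnS in mu.
rewrite coef_sub1X_exp mulrCA dvdz_mull //.
have binP : (p%:Z ^+ borrows p b s (u - m) %| 'C(s, u - m)%:Z)%Z.
  by rewrite dvdz_exp_natl dvdn_bin_borrows.
case: m mu binP => [|m] mu binP; first by rewrite subn0 in binP *; rewrite dvdz_mull.
have Gm : (p%:Z ^+ b %| G`_m.+1 *+ m.+1)%Z by rewrite -coef_deriv hG coefZ dvdz_mulr.
have := dvdz_mul (dvdz_exp_minn p b m.+1 _ pp isT Gm) binP; rewrite -exprD.
apply: dvdz_trans; apply: dvdz_exp2l; rewrite addnC.
apply: borrows_near; last exact: geq_minl.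
apply/eqP; rewrite eqn_mod_dvd ?leq_subr // subKn //.
by rewrite pfactor_dvdn // geq_minr.
Qed.

(** Differentiating the identity, both powers yield a factor [p ^ a], and one [p] cancels against
    the [p] before [h]. *)
Lemma deriv_frobenius (p a : nat) (h : {poly int}) : prime p ->
  (1 - 'X) ^+ (p ^ a) = 1 - 'X^(p ^ a) + p%:Z *: h ->
  exists E : {poly int}, h^`() = p%:Z ^+ a.-1 *: E.
Proof.
move=> pp; case: a => [|a] hE; first by exists h^`(); rewrite scale1r.
have p0 : p%:Z != 0 by rewrite eqz_nat -lt0n prime_gt0.
exists ('X^((p ^ a.+1).-1) - (1 - 'X) ^+ (p ^ a.+1).-1).
apply: (@mulfI _ p%:Z%:P); rewrite ?polyC_eq0 // !mul_polyC.
have := congr1 (@deriv _) hE.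
rewrite deriv_exp !derivD !derivN -!polyC1 !derivC derivX derivXn derivZ !add0r polyC1.
move=> /(canLR (addKr _)) <-; rewrite scalerA -exprS /= opprK.
by rewrite mulN1r -mulrnDl -scaler_nat natrX natz.
Qed.

(** For [k = 0] the derivative is zero and all [a] positions count; for [k > 0] its factor
    [p ^ a.-1] only allows [a.-1] positions. *)
Lemma dvdz_coef_frobenius (p a k s u : nat) (h : {poly int}) : prime p ->
  (1 - 'X) ^+ (p ^ a) = 1 - 'X^(p ^ a) + p%:Z *: h ->
  (p%:Z ^+ (borrows p a s u - (0 < k)) %| (h ^+ k * (1 - 'X) ^+ s)`_u)%Z.
Proof.
move=> pp hE; case: k => [|k].
  rewrite subn0; apply: (dvdz_coef_borrows _ _ _ _ _ 0) => //.
  by rewrite expr0 -polyC1 derivC scaler0.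
have [E dE] := deriv_frobenius p a h pp hE.
apply: (@dvdz_trans (p%:Z ^+ borrows p a.-1 s u)).
  apply: dvdz_exp2l; rewrite leq_subLR add1n.
  case: a {hE dE} => [|a] /=; first by rewrite /borrows big_ord0.
  exact: borrowsS.
apply: (dvdz_coef_borrows _ _ _ _ _ (E * h ^+ k *+ k.+1)) => //.
by rewrite deriv_exp dE /= -scalerAl scalerMnr.
Qed.

(** * Assembling the factors, and the bound on the order *)

Lemma geom_comp (q P M : nat) : geom q M \Po 'X^P = geom (q * P) M.
Proof.
rewrite /geom rmorph_sum /=; apply: eq_bigr => k _.
by rewrite rmorphXn /= rmorphXn /= comp_polyX -!exprM mulnA (mulnC P).
Qed.

(* Expand [(1-x)^n = ((1-x^P) + p h)^N (1-x)^s] with [P = p^a] and [n = N P + s]: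
   the term [k] is [C(N,k) p^k (1-x^P)^(N-k)] times [h^k (1-x)^s], and both
   [k!] and the borrow lost when [k > 0] are absorbed by [p^k]. *)
Lemma dvdz_coef_quotient (p a l n r M : nat) : prime p ->
  (n < r + l.+1 * p ^ a.+1)%N -> (r + l * p < M)%N ->
  (p%:Z ^+ (logn p (n %/ p ^ a)`! + borrows p a n r) %|
    (l`! * p ^ l)%:Z * ((1 - 'X) ^+ n * geom (p ^ a.+1) M ^+ l.+1)`_r)%Z.
Proof.
move=> pp nr rM; have [h sh hE] := sub1X_exp_frobenius p a pp.
set P := (p ^ a)%N in hE sh *; have P0 : (0 < P)%N by rewrite expn_gt0 prime_gt0.
set N := (n %/ P)%N; set s := (n %% P)%N.
have nE : n = (P * N + s)%N by rewrite mulnC -divn_eq.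
have -> : (1 - 'X) ^+ n = (1 - 'X^P + p%:Z *: h) ^+ N * (1 - 'X) ^+ s.
  by rewrite {1}nE exprD exprM hE.
rewrite exprDn !mulr_suml coef_sum mulr_sumr.
apply: rpred_sum => -[k /= kN] _; rewrite ltnS in kN.
have -> : (1 - 'X^P) ^+ (N - k) * (p%:Z *: h) ^+ k *+ 'C(N, k) * (1 - 'X) ^+ s
      * geom (p ^ a.+1) M ^+ l.+1
    = ('C(N, k)%:Z * p%:Z ^+ k) *: (h ^+ k * (1 - 'X) ^+ s
       * (((1 - 'X) ^+ (N - k) * geom p M ^+ l.+1) \Po 'X^P)).
  rewrite rmorphM /= !rmorphXn /= rmorphB /= comp_polyX rmorph1 geom_comp -expnS.
  rewrite -!mul_polyC exprMn rmorphM rmorphXn /= -(natz 'C(N, k)) rmorph_nat -mulr_natl.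
  by rewrite -!mulrA; congr (_ * _); rewrite mulrCA; congr (_ * _); rewrite mulrCA; congr (_ * _); rewrite mulrCA.
have sA : (size (h ^+ k * (1 - 'X) ^+ s)%R <= (k * P + s).+1)%N.
  apply: leq_trans (size_polyMleq _ _) _.
  by have := size_exp_leq h P k sh; have := size_sub1X_exp s; lia.
rewrite coefZ (coefM_size _ _ _ _ sA) !mulr_sumr.
apply: rpred_sum => -[u /= us] _; rewrite ltnS in us.
case: ltnP => ur; first by rewrite !mulr0 dvdz0.
rewrite coef_comp_poly_Xn //; case: ifP => [Pd|_]; last by rewrite !mulr0 dvdz0.
set e := ((r - u) %/ P)%N; have eE : (r - u = e * P)%N by rewrite divnK.
(* Only such [u] contribute, so the borrows for [s] and [u] are those for [n] and [r]. *)
have re : u = r %[mod P] by rewrite -(subnKC ur) eE addnC modnMDl.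
have base : (p%:Z ^+ logn p (N - k)`! %|
    (l`! * p ^ l)%:Z * ((1 - 'X) ^+ (N - k) * geom p M ^+ l.+1)`_e)%Z.
  apply: dvdz_coef_sub1X_geom => //; last first.
    by apply: leq_ltn_trans rM; rewrite leq_add2r (leq_trans (leq_div _ _)) ?leq_subr.
  (* Multiplied by [P], the claim [N - k < e + l.+1 * p] follows from the hypothesis on [r], as
     [u <= k * P + s]. *)
  rewrite -(ltn_pmul2r P0); rewrite expnS -/P in nr.
  have : (N - k + k = N)%N by rewrite subnK.
  move: (N - k)%N => i iN; rewrite nE -iN in nr; clear -nr eE us ur; nia.
have coefA := dvdz_coef_frobenius p a k s u h pp hE.
have binP : (p%:Z ^+ logn p 'C(N, k) %| 'C(N, k)%:Z)%Z.
  by rewrite dvdz_exp_natl pfactor_dvdnn.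
have -> : forall x y z w t : int, x * (y * z * (w * t)) = y * z * w * (x * t).
  by move=> x y z w t; ring.
apply: dvdz_trans (dvdz_mul (dvdz_mul (dvdz_mul binP (dvdzz _)) coefA) base).
rewrite -!exprD; apply: dvdz_exp2l.
rewrite -(borrows_mod p a s u n r) ?modn_mod //.
rewrite -(bin_fact kN) !lognM ?muln_gt0 ?bin_gt0 ?fact_gt0 ?kN //.
have := leq_logn_fact p k pp; have := prime_gt1 pp.
move: (logn p k`!) => L p1 hL.
have Lk : (L <= k.-1)%N.
  by apply: leq_trans hL; rewrite leq_pmull // -ltnS prednK // ltnW.
have : (L <= k - (0 < k))%N by case: (k) Lk => [|k'] //=; rewrite subn1.
clear -p1.
move: (borrows _ _ _ _) (logn _ _) (logn _ _) => *; lia.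
Qed.

(* c is the coefficient sequence of the power series (1-x)^n/(1-x^{p^alpha})^(l+1),
   characterized by (1-x^{p^alpha})^(l+1) * C(x) = (1-x)^n. *)
Theorem theorem1p3 (p alpha l n r : nat) (c : nat -> int) :
  prime p ->
  (forall m : nat,
     \sum_(j < m.+1) ((1 - 'X^(p ^ alpha)) ^+ l.+1 : {poly int})`_j * c (m - j)%N
     = ((1 - 'X) ^+ n : {poly int})`_m) ->
  n%:Z - (l.+1 * p ^ alpha)%:Z < r%:Z ->
  c r = 0 \/
  (logn p (floorp p alpha n)`!)%:Z - l%:Z - (logn p l`!)%:Z
    + (tau p (fracp p alpha r%:Z) (fracp p alpha (n%:Z - r%:Z)))%:Z
  <= (ordp p (c r))%:Z.
Proof.
move=> pp hc; rewrite ltrBlDr -PoszD ltz_nat => nr; have p1 := prime_gt1 pp.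
have P0 k : (0 < p ^ k)%N by rewrite expn_gt0 prime_gt0.
(* The length leaves room for the [l] index shifts by [p] in [dvdz_coef_sub1X_geom]. *)
have cE := coef_quotient _ (r + l * p).+1 _ _ c r (P0 alpha) _ hc.
have {}cE := cE (leq_addr _ _).
have [->|c0] := eqVneq (c r) 0; [by left|right].
case: alpha nr cE {hc} => [|a] nr cE.
  rewrite expn0 in nr cE; rewrite /= /tau big_ord1 /= /digit div0n mod0n leqNgt ltnW //=.
  have nl : (n <= l)%N.
    rewrite leqNgt; apply/negP => ln; case/eqP: c0; rewrite cE.
    have -> : (1 - 'X) ^+ n = (1 - 'X^1) ^+ l.+1 * (1 - 'X) ^+ (n - l.+1) :> {poly int}.
      by rewrite expr1 -exprD subnKC.
    rewrite -[X in geom _ _ ^+ X]add0n.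
    rewrite geomK_exp ?leq_addr // expr0 mulr1 nth_default //.
    by apply: leq_trans (size_sub1X_exp _) _; lia.
  (* The order of [(p * n)!] is [n] plus that of [n!], and [n!] divides [l!]. *)
  have : (logn p (p * n)`! <= l + logn p l`!)%N.
    rewrite logn_fact_div // mulKn ?prime_gt0 // leq_add // dvdn_leq_log ?fact_gt0 //.
    by rewrite -(bin_fact nl) mulnCA dvdn_mulr.
  rewrite addr0; lia.
have := dvdz_coef_quotient p a l n r _ pp nr (ltnSn _); rewrite -cE.
rewrite dvdz_exp_natl pfactor_dvdn ?absz_gt0 ?mulf_neq0 //; last first.
  by rewrite eqz_nat -lt0n muln_gt0 fact_gt0 P0.
rewrite abszM absz_nat !lognM ?muln_gt0 ?fact_gt0 ?P0 ?absz_gt0 //.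
rewrite pfactorK // -/(ordp p (c r)).
set x := fracp _ _ r%:Z; set y := fracp _ _ _; suff : (tau p x y <= borrows p a n r)%N.
  rewrite [floorp _ _ _]/=; move: (tau _ _ _) (borrows _ _ _ _) (logn _ _) (logn _ _) (ordp _ _).
  by move=> *; lia.
have Q0 : (p ^ a)%:Z != 0 by rewrite eqz_nat -lt0n.
have xE : x = (r %% p ^ a)%N by rewrite /x /= modz_nat absz_nat.
have yE : y%:Z = ((n%:Z - r%:Z) %% (p ^ a)%:Z)%Z by rewrite /y /= gez0_abs // modz_ge0.
apply: tau_le_borrows => //.
- by rewrite xE ltn_pmod.
- by rewrite -ltz_nat yE ltz_pmod // ltz_nat.
- by rewrite xE modn_mod.
apply/eqP; rewrite -eqz_nat -!modz_nat PoszD yE xE -modz_nat.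
by rewrite modzDm addrC subrK.
Qed.
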